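(* Let $G$ be a finite group. The property, for functions $f:G\to\mathbb{D}$, of being proportional to an irreducible character (that is, $f=c\,\chi_\varphi$ for some $c\in\mathbb{C}$ and some irreducible representation $\varphi$ of $G$) has a tester with query complexity $O(\epsilon^{-8}\log^2(1/\epsilon))$, where the constant in the $O(\cdot)$ does not depend on $G$.
   Context: $\mathbb{D}=\{z\in\mathbb{C}: |z|\le 1\}$. A representation of $G$ is a homomorphism $\varphi:G\to \mathrm{GL}_d(\mathbb{C})$; it is irreducible if the only subspaces of $\mathbb{C}^d$ invariant under all $\varphi(x)$ are $\{0\}$ and $\mathbb{C}^d$. Its character is $\chi_\varphi(x)=\mathrm{tr}(\varphi(x))$. For $f,g:G\to\mathbb{D}$, $\mathrm{dist}(f,g)=\frac12\|f-g\|_2$ with $\|h\|_2=\sqrt{\mathbf{E}_{x\in G}|h(x)|^2}$ ($x$ uniform in $G$). A function $f$ is $\epsilon$-far from a property $\mathcal{P}$ if $\mathrm{dist}(f,g)\ge\epsilon$ for every $g:G\to\mathbb{D}$ satisfying $\mathcal{P}$. A tester for $\mathcal{P}$ is a randomized algorithm that, given $\epsilon>0$ and query access to $f:G\to\mathbb{D}$ (it may sample uniform elements of $G$ and perform group operations), accepts with probability at least $2/3$ if $f$ satisfies $\mathcal{P}$ and rejects with probability at least $2/3$ if $f$ is $\epsilon$-far from $\mathcal{P}$. The query complexity is the number of queries to $f$. *)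

(* Defs.v *)
From HB Require Import structures.
From mathcomp Require Import all_boot all_order all_algebra all_fingroup.
From mathcomp Require Import mxrepresentation complex.
From mathcomp Require Import reals exp.

Set Implicit Arguments.
Unset Strict Implicit.
Unset Printing Implicit Defensive.

Import Order.TTheory GRing.Theory Num.Theory.
Import ComplexField.

Local Open Scope ring_scope.

Section Functions.
Variables (R : realType) (gT : finGroupType).
Implicit Types f g : gT -> R[i].

Definition disk_valued f : Prop := forall x, Normc.normc (f x) <= 1.

Definition norm2 f : R :=
  Num.sqrt ((\sum_(x : gT) Normc.normc (f x) ^+ 2) / #|gT|%:R).

Definition dist f g : R := norm2 (fun x => f x - g x) / 2.

Definition eps_far (P : (gT -> R[i]) -> Prop) (eps : R) f : Prop :=
  forall g, disk_valued g -> P g -> eps <= dist f g.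

(* [mx_irreducible] excludes the degree d = 0; since c may be 0, admitting that
   degree would not change this property. *)
Definition proportional_to_irreducible_character f : Prop :=
  exists (c : R[i]) (d : nat) (phi : mx_representation R[i] [set: gT]%G d),
    mx_irreducible phi /\ forall x, f x = c * \tr (phi x).

End Functions.

(* Group elements that can be computed from the elements sampled so far:
   [Sampled i] is the i-th sample, counted from 0. *)
Inductive group_word : Type :=
| Sampled of nat
| WordOne
| WordMul of group_word & group_word
| WordInv of group_word.

(* A randomized query algorithm, as a decision tree.  It reaches the group only
   through uniform samples, the group operations and comparison of elements,
   and f only through queries; computation on the complex answers is free.  A
   run is finite because the type is inductive. *)
Inductive algorithm (R : realType) : Type :=
| Answer of bool (* true = accept *)
| Toss of algorithm R & algorithm R
| Sample of algorithm R
| Compare of group_word & group_word & algorithm R & algorithm R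
| Query of group_word & (R[i] -> algorithm R).

Section Execution.
Variables (R : realType) (gT : finGroupType).
Implicit Types (f : gT -> R[i]) (s : seq gT) (a : algorithm R).

Fixpoint eval_word s (w : group_word) : gT :=
  match w with
  | Sampled i => nth 1%g s i
  | WordOne => 1%g
  | WordMul u v => (eval_word s u * eval_word s v)%g
  | WordInv u => (eval_word s u)^-1%g
  end.

(* Probability that [a] returns [b] on oracle [f], after sampling [s]. *)
Fixpoint output_prob f (b : bool) s a : R :=
  match a with
  | Answer b' => (b' == b)%:R
  | Toss a1 a2 => (output_prob f b s a1 + output_prob f b s a2) / 2
  | Sample a' => (\sum_(x : gT) output_prob f b (rcons s x) a') / #|gT|%:R
  | Compare u v a1 a2 =>
      if eval_word s u == eval_word s v then output_prob f b s a1
      else output_prob f b s a2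
  | Query w k => output_prob f b s (k (f (eval_word s w)))
  end.

(* Number of queries in the worst case over the random choices. *)
Fixpoint max_queries f s a : nat :=
  match a with
  | Answer _ => 0
  | Toss a1 a2 => maxn (max_queries f s a1) (max_queries f s a2)
  | Sample a' => \max_(x : gT) max_queries f (rcons s x) a'
  | Compare u v a1 a2 =>
      if eval_word s u == eval_word s v then max_queries f s a1
      else max_queries f s a2
  | Query w k => (max_queries f s (k (f (eval_word s w)))).+1
  end.

Definition accept_prob f a : R := output_prob f true [::] a.
Definition reject_prob f a : R := output_prob f false [::] a.

Definition is_tester (P : (gT -> R[i]) -> Prop) (T : R -> algorithm R) : Prop :=
  forall eps : R, 0 < eps -> forall f, disk_valued f ->
    (P f -> 2 / 3 <= accept_prob f (T eps)) /\
    (eps_far P eps f -> 2 / 3 <= reject_prob f (T eps)).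

Definition query_complexity_le (T : R -> algorithm R) (q : R -> R) : Prop :=
  forall eps : R, 0 < eps -> forall f, disk_valued f ->
    (max_queries f [::] (T eps))%:R <= q eps.

End Execution.

(* Main.v *)
(* Put a = f(1) and consider the defect
     D = E_{x,y} |f(x) f(y) - a E_z f(x z y z^-1)|^2.
   If f is a multiple of an irreducible character then D = 0, by Schur's lemma.
   Conversely, the operators A_y : f |-> E_z f(. z y z^-1) on functions on G
   commute, and A_y^* = A_{y^-1}; hence they have a common orthonormal
   eigenbasis u_i, and their eigenvalues w_i(y) are normalized irreducible
   characters, afforded by any simple submodule of the module that u_i
   generates.  Writing f = sum_i alpha_i u_i, one gets
     D = sum_i |alpha_i|^2 ||f - a w_i||^2.
   If f is eps-far from the property, then ||f|| and all the ||f - a w_i|| are at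
   least 2 eps, since 0 and a w_i have the property and values in the unit disk;
   thus D >= 16 eps^4.  The tester averages about eps^-8 independent copies of a
   bounded unbiased estimator of D that makes four queries, and Chebyshev's
   inequality bounds its error.  For eps > 1/2 no function is eps-far, because 0
   has the property, and for eps <= 1/2 the factor ln(1/eps)^2 is at least
   ln(2)^2, so the bound eps^-8 is enough. *)
Require Import Defs.
From HB Require Import structures.
From mathcomp Require Import all_boot all_order all_algebra all_fingroup.
From mathcomp Require Import mxrepresentation complex.
From mathcomp Require Import mxred spectral sesquilinear.
From mathcomp Require Import reals exp.
From mathcomp Require Import ring lra.

Set Implicit Arguments.
Unset Strict Implicit.
Unset Printing Implicit Defensive.

Import Order.TTheory GRing.Theory Num.Theory.

Local Open Scope ring_scope.

(** * Conjugation averages in representations and normalized irreducible characters *)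

Section ClassMeans.
Variables (C : numClosedFieldType) (gT : finGroupType).

Definition conj_mean (f : gT -> C) x y : C :=
  (\sum_(z : gT) f (x * (z * y * z^-1))%g) / #|gT|%:R.

Lemma card_group_neq0 : #|gT|%:R != 0 :> C.
Proof. by rewrite pnatr_eq0 -lt0n; apply/card_gt0P; exists 1%g. Qed.

(** Image of the normalized class sum of [y]: running over all [z] counts each conjugate equally
    often. *)
Definition class_mean n (rG : mx_representation C [set: gT]%G n) (y : gT) :=
  #|gT|%:R^-1 *: \sum_(z : gT) rG (z * y * z^-1)%g.

Lemma class_mean_centg n (rG : mx_representation C [set: gT]%G n) y :
  centgmx rG (class_mean rG y).
Proof.
apply/centgmxP => x _; rewrite /class_mean -scalemxAl -scalemxAr; congr (_ *: _).
rewrite mulmx_suml mulmx_sumr (reindex_inj (mulgI x)) /=; apply: eq_bigr => z _.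
by rewrite -!repr_mxM ?inE // invMg !mulgA mulgKV.
Qed.

Lemma mxtrace_class_mean n (rG : mx_representation C [set: gT]%G n) y :
  \tr (class_mean rG y) = \tr (rG y).
Proof.
rewrite /class_mean mxtraceZ raddf_sum (eq_bigr (fun=> \tr (rG y))) => [|z _].
  by rewrite sumr_const -[\tr _ *+ _]mulr_natl mulKf ?card_group_neq0.
rewrite /= !repr_mxM ?inE // mxtrace_mulC mulmxA -repr_mxM ?inE //.
by rewrite mulVg repr_mx1 mul1mx.
Qed.

(** Schur's lemma: subtracting an eigenvalue leaves a singular element of the centralizer, hence
    zero; the trace then identifies the scalar. *)
Lemma class_mean_irr d (phi : mx_representation C [set: gT]%G d) y :
  mx_irreducible phi -> class_mean phi y = (\tr (phi y) / d%:R)%:M.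
Proof.
move=> irr; have [d_gt0 _] := (mx_irrP phi).1 irr.
have dN0 : d%:R != 0 :> C by rewrite pnatr_eq0 -lt0n.
have [w /eigenvalueP[v vw vN0]] := eigenvalue_closed (class_mean phi y) d_gt0.
have cent : centgmx phi (class_mean phi y - w%:M).
  apply/centgmxP => x Gx; rewrite mulmxBl mulmxBr scalar_mxC.
  by rewrite ((centgmxP (class_mean_centg _ _)) x Gx).
have cmw : class_mean phi y = w%:M.
  apply/eqP; rewrite -subr_eq0; apply: contraNT vN0 => /(mx_Schur irr cent) u.
  rewrite -(mulmxK u v) mulmxBr vw mul_mx_scalar subrr mul0mx //.
by rewrite -mxtrace_class_mean cmw mxtrace_scalar -[w *+ d]mulr_natr mulfK.
Qed.

Lemma conj_mean_irr_char d (phi : mx_representation C [set: gT]%G d) x y :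
  mx_irreducible phi ->
  conj_mean (fun u => \tr (phi u)) x y = \tr (phi x) * \tr (phi y) / d%:R.
Proof.
move=> irr; transitivity (\tr (phi x *m class_mean phi y)).
  rewrite /class_mean -scalemxAr mxtraceZ mulmx_sumr raddf_sum /= mulrC.
  by congr (_ / _); apply: eq_bigr => z _; rewrite repr_mxM ?inE.
by rewrite class_mean_irr // mul_mx_scalar mxtraceZ mulrC mulrA.
Qed.

Lemma class_mean_submod n (rG : mx_representation C [set: gT]%G n)
    (U : 'M_n) (modU : mxmodule rG U) (w : C) y :
  U *m class_mean rG y = w *: U -> class_mean (submod_repr modU) y = w%:M.
Proof.
move=> Uw; apply: (@val_submod_inj _ _ U).
have vw : val_submod 1%:M *m class_mean rG y = w *: val_submod (1%:M : 'M_(\rank U)).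
  have /submxP[X ->] : (val_submod (1%:M : 'M_(\rank U)) <= U)%MS by exact: val_submodP.
  by rewrite -mulmxA Uw scalemxAr.
rewrite -scalemx1 [RHS]linearZ /= -[RHS]vw.
rewrite -[class_mean _ y]mul1mx /class_mean -!scalemxAr linearZ /=; congr (_ *: _).
rewrite !mulmx_sumr linear_sum /=; apply: eq_bigr => z _.
by rewrite val_submodJ ?inE.
Qed.

(** The class mean commutes with the enveloping algebra, so the whole cyclic module of [u] lies in
    its [w y]-eigenspace; on a simple submodule the trace turns [w] into a normalized character. *)
Lemma irr_char_of_eigenvector n (rG : mx_representation C [set: gT]%G n)
    (u : 'rV_n) (w : gT -> C) :
  u != 0 -> (forall y, u *m class_mean rG y = w y *: u) ->
  exists d (phi : mx_representation C [set: gT]%G d),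
    mx_irreducible phi /\ forall y, w y = \tr (phi y) / d%:R.
Proof.
move=> uN0 uw.
have [|V simV sVU] := dec_mxsimple_exists (cyclic_mx_module rG u).
  by rewrite cyclic_mx_eq0.
have irr := (submod_mx_irr (mxsimple_module simV)).2 simV.
exists (\rank V), (submod_repr (mxsimple_module simV)); split=> // y.
have Vw : V *m class_mean rG y = w y *: V.
  apply/row_matrixP => i; rewrite row_mul [row i (_ *: _)]linearZ /=.
  have /cyclic_mxP[A A_E ->] := submx_trans (row_sub i V) sVU.
  rewrite scalemxAl -uw -!mulmxA; congr (_ *m _).
  by have := class_mean_centg rG y; rewrite -memmx_cent_envelop => /cent_mxP->.
have [d_gt0 _] := (mx_irrP _).1 irr.
rewrite -mxtrace_class_mean (class_mean_submod _ Vw) mxtrace_scalar.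
by rewrite -[w y *+ _]mulr_natr mulfK // pnatr_eq0 -lt0n.
Qed.

End ClassMeans.

(** * Simultaneous unitary diagonalization *)

Section UnitaryDiagonalization.
Variable C : numClosedFieldType.
Local Open Scope sesquilinear_scope.

(** One unitary change of basis makes all [A i] triangular; the adjoint of [A i] is in the family
    too, so the entries on both sides of the diagonal vanish. *)
Lemma unitary_codiagonalization n (I : finType) (A : I -> 'M[C]_n) :
    (forall i j, comm_mx (A i) (A j)) -> (forall i, exists j, (A i)^t* = A j) ->
  exists2 P : 'M[C]_n, P \is unitarymx &
    forall i, exists D : 'rV_n, P *m A i = diag_mx D *m P.
Proof.
move=> comA adjA; have [|P Pu /allP trigP] := @cotrigonalization C n (codom A).
  by move=> _ _ /codomP[i ->] /codomP[j ->].
have trig i : is_trig_mx (P *m A i *m P^t*).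
  by rewrite -conjymx //; apply: trigP; apply: codom_f.
have PK : P^t* *m P = 1%:M by rewrite -(invmx_unitary Pu) mulVmx ?unitarymx_unit.
exists P => // i; have [j Aij] := adjA i.
suff /diag_mxP[D PAP] : is_diag_mx (P *m A i *m P^t*).
  by exists D; rewrite -PAP -mulmxA PK mulmx1.
apply/is_diag_mxP => k l; case: ltngtP => // [lt_kl|lt_lk] _.
  by have /is_trig_mxP-> := trig i.
have /is_trig_mxP/(_ l k lt_lk)/eqP := trig j.
rewrite -Aij -{1}[P]trmxCK -!map_mxM -!trmx_mul mulmxA 2!mxE conjC_eq0.
by move/eqP.
Qed.

Lemma sum_sqr_norm_cV n (v : 'cV[C]_n) :
  \sum_i `|v i 0| ^+ 2 = (v^t* *m v) 0 0.
Proof. by rewrite mxE; apply: eq_bigr => i _; rewrite normCK 2!mxE mulrC. Qed.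

Lemma sum_sqr_norm_unitary n (P : 'M[C]_n) (v : 'cV[C]_n) :
  P \is unitarymx -> \sum_i `|(P *m v) i 0| ^+ 2 = \sum_i `|v i 0| ^+ 2.
Proof.
move=> Pu; rewrite !sum_sqr_norm_cV trmx_mul map_mxM mulmxA mulmxKtV //.
Qed.

End UnitaryDiagonalization.

(** * Spectral decomposition of the defect in the regular representation *)

Section Defect.
Variables (C : numClosedFieldType) (gT : finGroupType).
Local Open Scope sesquilinear_scope.
Local Notation reg := (regular_repr C [set: gT]%G).

Lemma regular_adjoint x : (reg x)^t* = reg x^-1%g.
Proof.
apply/matrixP => i j; rewrite !mxE conjC_nat; congr (_%:R).
rewrite !eqxx -!(inj_eq enum_val_inj) !gring_indexK ?inE //=.
by congr nat_of_bool; apply/eqP/eqP => ->; rewrite ?mulgK ?mulgKV.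
Qed.

(** Columns, so that [reg x] acts by right translation and [class_mean reg y] by
    [f |-> conj_mean f _ y]. *)
Definition fun_col (f : gT -> C) : 'cV[C]_(gcard [set: gT]%G) :=
  \col_i f (enum_val i).

Lemma sum_fun_col (h : gT -> C) :
  \sum_x h x = \sum_(i < gcard [set: gT]%G) h (enum_val i).
Proof. by rewrite -big_enum_val /=; apply: eq_bigl => x; rewrite inE. Qed.

Lemma class_mean_adjoint y : (class_mean reg y)^t* = class_mean reg y^-1%g.
Proof.
rewrite /class_mean linearZ /= map_mxZ linear_sum map_mx_sum.
congr (_ *: _); first by rewrite fmorphV /= conjC_nat.
by apply: eq_bigr => z _; rewrite regular_adjoint !invMg invgK mulgA.
Qed.

Lemma class_mean_reg_comm y z : comm_mx (class_mean reg y) (class_mean reg z).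
Proof.
have := class_mean_centg reg z; rewrite -memmx_cent_envelop => /cent_mxP; apply.
rewrite /class_mean linearZ /= scalemx_sub // linear_sum summx_sub // => t _.
by rewrite envelop_mx_id ?inE.
Qed.

Lemma regular_fun_col f x :
  reg x *m fun_col f = fun_col (fun u => f (u * x)%g).
Proof.
apply/row_matrixP => i; rewrite row_mul rowK -rowE; apply/rowP => j.
by rewrite !mxE gring_indexK ?inE.
Qed.

Lemma class_mean_fun_col f y :
  class_mean reg y *m fun_col f = fun_col (fun x => conj_mean f x y).
Proof.
rewrite /class_mean -scalemxAl mulmx_suml.
rewrite (eq_bigr _ (fun z _ => regular_fun_col f _)); apply/colP => i.
by rewrite 2!mxE summxE mulrC; congr (_ / _); apply: eq_bigr => z _; rewrite mxE.
Qed.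

(** In the common eigenbasis the double sum splits into the squared coordinates of [f], each
    weighted by a sum of the kind that [B] bounds from below. *)
Lemma defect_ge (f : gT -> C) (a B : C) :
    (forall d (phi : mx_representation C [set: gT]%G d), mx_irreducible phi ->
       B <= \sum_y `|f y - a * (\tr (phi y) / d%:R)| ^+ 2) ->
  B * \sum_x `|f x| ^+ 2 <=
    \sum_y \sum_x `|f x * f y - a * conj_mean f x y| ^+ 2.
Proof.
move=> hB.
have [|P Pu diagP] := unitary_codiagonalization class_mean_reg_comm.
  by move=> y; exists y^-1%g; exact: class_mean_adjoint.
have {diagP} [w PA] : exists w : gT -> 'rV[C]_(gcard [set: gT]%G),
    forall y, P *m class_mean reg y = diag_mx (w y) *m P.
  (* Reading the eigenvalues off the diagonal of [P *m class_mean reg y *m P^t*] gives [w] as a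
     function of [y] without a choice principle. *)
  exists (fun y => \row_i (P *m class_mean reg y *m P^t*) i i) => y.
  have [D PD] := diagP y; rewrite PD; congr (diag_mx _ *m _).
  by apply/rowP => i; rewrite mxE -mulmxA (unitarymxP Pu) mulmx1 mxE eqxx mulr1n.
set alpha := P *m fun_col f.
have normE : \sum_x `|f x| ^+ 2 = \sum_i `|alpha i 0| ^+ 2.
  rewrite sum_sqr_norm_unitary // sum_fun_col.
  by apply: eq_bigr => i _; rewrite mxE.
rewrite normE. have E y : \sum_x `|f x * f y - a * conj_mean f x y| ^+ 2 =
    \sum_i `|alpha i 0| ^+ 2 * `|f y - a * w y 0 i| ^+ 2.
  pose v := f y *: fun_col f - a *: (class_mean reg y *m fun_col f).
  transitivity (\sum_i `|v i 0| ^+ 2).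
    rewrite sum_fun_col; apply: eq_bigr => i _.
    by rewrite /v class_mean_fun_col !mxE [f y * _]mulrC.
  rewrite -(sum_sqr_norm_unitary v Pu); apply: eq_bigr => i _.
  rewrite /v mulmxBr -!scalemxAr mulmxA PA -mulmxA -/alpha mul_diag_mx !mxE.
  by rewrite mulrA -mulrBl normrM exprMn mulrC.
rewrite (eq_bigr _ (fun y _ => E y)) exchange_big mulr_sumr /=.
apply: ler_sum => i _; rewrite -mulr_sumr mulrC ler_wpM2l ?exprn_ge0 //.
(* Row [i] of [P] is a common left eigenvector, nonzero because [P] is unitary. *)
have [||d [phi [irr wE]]] := @irr_char_of_eigenvector C gT _ reg (row i P) (fun y => w y 0 i).
- apply/eqP => /(congr1 (mulmx^~ (P^t*))).
  rewrite -row_mul (unitarymxP Pu) mul0mx => /rowP/(_ i).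
  by rewrite !mxE eqxx => /eqP; rewrite oner_eq0.
- by move=> y; rewrite -row_mul PA row_mul row_diag_mx -scalemxAl -rowE.
rewrite (eq_bigr _ (fun y _ => congr1 (fun c => `|f y - a * c| ^+ 2) (wE y))).
exact: hB irr.
Qed.

End Defect.

(** * The defect of multiples of irreducible characters and of far functions *)

Section TestIdentity.
Variables (R : realType) (gT : finGroupType).
Local Notation normc := ComplexField.Normc.normc.
Local Notation prop_char := (@proportional_to_irreducible_character R gT).
Implicit Types f : gT -> R[i].

Lemma normr_complexE (z : R[i]) : `|z| = (normc z)%:C%C.
Proof. by []. Qed.

Lemma normc_ge0 (z : R[i]) : 0 <= normc z.
Proof. by case: z => a b; exact: sqrtr_ge0. Qed.

Lemma normc_sum (I : finType) (F : I -> R[i]) :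
  normc (\sum_i F i) <= \sum_i normc (F i).
Proof.
elim/big_rec2: _ => [|i x y _ le_yx]; first by rewrite ComplexField.Normc.normc0.
by apply: le_trans (le_normcD _ _) _; rewrite lerD2l.
Qed.

Lemma normc_nat n : normc n%:R = n%:R :> R.
Proof. by apply: (@complexI R); rewrite -normr_complexE normr_nat rmorph_nat. Qed.

Lemma group_card_gt0 : 0 < #|gT|%:R :> R.
Proof. by rewrite ltr0n; apply/card_gt0P; exists 1%g. Qed.

(** Maximum principle: [w x * w z] is a mean of values of [w]; take [z] where the modulus of [w] is
    largest and divide by that maximum. *)
Lemma irr_char_le1 d (phi : mx_representation R[i] [set: gT]%G d) y :
  mx_irreducible phi -> normc (\tr (phi y) / d%:R) <= 1.
Proof.
move=> irr; have [d_gt0 _] := (mx_irrP phi).1 irr.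
have dN0 : d%:R != 0 :> R[i] by rewrite pnatr_eq0 -lt0n.
pose w x := \tr (phi x) / d%:R.
have wM x z : w x * w z = conj_mean w x z.
  transitivity (conj_mean (fun u => \tr (phi u)) x z / d%:R).
    by rewrite conj_mean_irr_char // /w mulrACA -!mulrA -invfM.
  by rewrite /conj_mean mulrAC mulr_suml.
have w1 : w 1%g = 1 by rewrite /w repr_mx1 mxtrace1 divff.
pose m := [arg max_(x > 1%g) normc (w x)]%O.
have wm x : normc (w x) <= normc (w m).
  by rewrite /m; case: arg_maxP => // x0 _; apply.
have wm_gt0 : 0 < normc (w m).
  by apply: lt_le_trans (wm 1%g); rewrite w1 ComplexField.Normc.normc1.
rewrite -(ler_pM2r wm_gt0) mul1r -ComplexField.Normc.normcM.
rewrite -/(w y) wM /conj_mean ComplexField.Normc.normcM ComplexField.Normc.normcV.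
rewrite normc_nat ler_pdivrMr ?group_card_gt0 //.
apply: le_trans (normc_sum _) _.
apply: le_trans (ler_sum _ (fun z _ => wm _)) _.
by rewrite sumr_const mulr_natr.
Qed.

(** The degree in [f 1%g = c * d] cancels the denominator in [conj_mean_irr_char]. *)
Lemma prop_char_conj_mean f x y :
  prop_char f -> f x * f y = f 1%g * conj_mean f x y.
Proof.
case=> c [d [phi [irr fE]]]; have [d_gt0 _] := (mx_irrP phi).1 irr.
have dN0 : d%:R != 0 :> R[i] by rewrite pnatr_eq0 -lt0n.
have -> : conj_mean f x y = c * conj_mean (fun u => \tr (phi u)) x y.
  rewrite /conj_mean mulrA mulr_sumr; congr (_ / _).
  by apply: eq_bigr => z _; rewrite fE.
by rewrite conj_mean_irr_char // !fE repr_mx1 mxtrace1; field.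
Qed.

(** Even with [c = 0] an irreducible representation must be exhibited: a simple submodule of the
    regular one. *)
Lemma prop_char0 : prop_char (fun=> 0).
Proof.
pose reg := regular_repr R[i] [set: gT]%G.
have [|V simV _] := dec_mxsimple_exists (mxmodule1 reg).
  by rewrite -mxrank_eq0 mxrank1 -lt0n; apply/card_gt0P; exists 1%g; rewrite inE.
exists 0, (\rank V), (submod_repr (mxsimple_module simV)); split.
  exact/submod_mx_irr.
by move=> x; rewrite mul0r.
Qed.

Lemma eps_far_sum f g (eps : R) : 0 < eps -> eps_far prop_char eps f ->
  disk_valued g -> prop_char g ->
  4 * eps ^+ 2 * #|gT|%:R <= \sum_x normc (f x - g x) ^+ 2.
Proof.
move=> eps_gt0 far dg pg; have := far g dg pg.
rewrite /dist ler_pdivlMr // /norm2 => le_eps.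
have : (eps * 2) ^+ 2 <= (\sum_x normc (f x - g x) ^+ 2) / #|gT|%:R.
  rewrite -[leRHS]sqr_sqrtr; first by rewrite ler_sqr ?nnegrE ?sqrtr_ge0 // mulr_ge0 // ltW.
  by rewrite divr_ge0 // sumr_ge0 // => x _; rewrite sqr_ge0.
rewrite ler_pdivlMr ?group_card_gt0 // => le2; apply: le_trans le2.
by rewrite le_eqVlt; apply/orP; left; apply/eqP; ring.
Qed.

Definition defect f : R :=
  (\sum_x (\sum_y normc (f x * f y - f 1%g * conj_mean f x y) ^+ 2) / #|gT|%:R)
    / #|gT|%:R.

Lemma defect0 f : prop_char f -> defect f = 0.
Proof.
move=> pf; rewrite /defect big1 ?mul0r // => x _; rewrite big1 ?mul0r // => y _.
by rewrite (prop_char_conj_mean x y pf) subrr ComplexField.Normc.normc0 expr0n.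
Qed.

Lemma eps_far_defect f (eps : R) : 0 < eps -> disk_valued f ->
  eps_far prop_char eps f -> 16 * eps ^+ 4 <= defect f.
Proof.
move=> eps_gt0 df far; set n : R := #|gT|%:R; have n_gt0 : 0 < n := group_card_gt0.
have := @defect_ge R[i] gT f (f 1%g) (4 * eps ^+ 2 * n)%:C%C.
have sqC (z : R[i]) : `|z| ^+ 2 = (normc z ^+ 2)%:C%C by rewrite normr_complexE rmorphXn.
have -> : \sum_y \sum_x `|f x * f y - f 1%g * conj_mean f x y| ^+ 2 =
    (defect f * n * n)%:C%C.
  rewrite exchange_big /defect divfK ?gt_eqF // -mulr_suml divfK ?gt_eqF //.
  rewrite rmorph_sum; apply: eq_bigr => x _; rewrite rmorph_sum.
  by apply: eq_bigr => y _; rewrite sqC.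
rewrite (eq_bigr _ (fun x _ => sqC (f x))) -rmorph_sum -rmorphM.
rewrite lecR => /(_ _)/wrap[].
  (* The competitor is [f 1%g] times a normalized character: disk-valued by [irr_char_le1], and
     proportional to [\tr (phi y)] with constant [f 1%g / d%:R]. *)
  move=> d phi irr; rewrite (eq_bigr _ (fun x _ => sqC _)) -rmorph_sum lecR.
  apply: eps_far_sum => //.
    move=> y; rewrite ComplexField.Normc.normcM.
    by rewrite mulr_ile1 ?normc_ge0 ?irr_char_le1 //; apply: df.
  exists (f 1%g / d%:R), d, phi; split=> // y.
  by rewrite -!mulrA; congr (_ * _); rewrite mulrC.
(* The competitor 0 bounds the other factor, the squared norm of [f]. *)
move=> le1; have := eps_far_sum eps_gt0 far _ prop_char0.
move=> /(_ _)/wrap[]; first by move=> x; rewrite ComplexField.Normc.normc0.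
under eq_bigr do rewrite subr0; rewrite -/n => le2.
have e2_gt0 : 0 < eps ^+ 2 by rewrite exprn_gt0.
rewrite -(ler_pM2r n_gt0) -(ler_pM2r n_gt0); apply: le_trans le1.
rewrite (_ : 16 * eps ^+ 4 * n * n = 4 * eps ^+ 2 * n * (4 * eps ^+ 2 * n)); last by ring.
by rewrite ler_pM2l // !mulr_gt0.
Qed.

End TestIdentity.

(** * Means over the group *)

Section Means.
Variables (R : realType) (gT : finGroupType).
Local Notation normc := ComplexField.Normc.normc.
Implicit Types F G : gT -> R.

Definition mean F : R := (\sum_x F x) / #|gT|%:R.

Lemma eq_mean F G : F =1 G -> mean F = mean G.
Proof. by move=> FG; rewrite /mean (eq_bigr _ (fun x _ => FG x)). Qed.

Lemma le_mean F G : (forall x, F x <= G x) -> mean F <= mean G.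
Proof.
move=> FG; rewrite /mean ler_pM2r ?invr_gt0 ?group_card_gt0 //.
by apply: ler_sum => x _; apply: FG.
Qed.

Lemma mean_quadratic F G (a b c : R) :
  mean (fun x => a + b * F x + c * G x) = a + b * mean F + c * mean G.
Proof.
rewrite /mean !big_split -!mulr_sumr sumr_const /= -[a *+ _]mulr_natr.
have := gt_eqF (group_card_gt0 R gT); set n := #|gT|%:R => nN0.
by field; rewrite nN0.
Qed.

Lemma mean_cst (a : R) : mean (fun=> a) = a.
Proof.
by rewrite /mean sumr_const -[a *+ _]mulr_natr mulfK // gt_eqF ?group_card_gt0.
Qed.

Definition mean4 (H : gT -> gT -> gT -> gT -> R) : R :=
  mean (fun x => mean (fun y => mean (fun z => mean (H x y z)))).

Lemma le_mean4 (H K : gT -> gT -> gT -> gT -> R) :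
  (forall x y z t, H x y z t <= K x y z t) -> mean4 H <= mean4 K.
Proof. by move=> HK; do 4![apply: le_mean => ?]. Qed.

Lemma mean4_quadratic (H K : gT -> gT -> gT -> gT -> R) (a b c : R) :
  mean4 (fun x y z t => a + b * H x y z t + c * K x y z t) =
    a + b * mean4 H + c * mean4 K.
Proof.
rewrite -mean_quadratic; apply: eq_mean => x.
rewrite -mean_quadratic; apply: eq_mean => y.
by rewrite -mean_quadratic; apply: eq_mean => z; rewrite mean_quadratic.
Qed.

Lemma mean4_cst (a : R) : mean4 (fun _ _ _ _ => a) = a.
Proof.
rewrite -[RHS]mean_cst; apply: eq_mean => x.
rewrite -[RHS]mean_cst; apply: eq_mean => y.
by rewrite -[RHS]mean_cst; apply: eq_mean => z; rewrite mean_cst.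
Qed.

(** For independent [z] and [t] the mean of the product is the product of the means; hence a squared
    modulus of a mean can be estimated without bias. *)
Lemma mean_Re_mul_conj (q : gT -> R[i]) :
  mean (fun z => mean (fun t => complex.Re (q z * (q t)^*%C))) =
    normc ((\sum_z q z) / #|gT|%:R) ^+ 2.
Proof.
have ReD : {morph @complex.Re R : x y / x + y} by move=> [a b] [c d].
have Re0 : complex.Re (0 : R[i]) = 0 by [].
rewrite /mean -mulr_suml (eq_bigr _ (fun z _ => esym (big_morph _ ReD Re0 _ _ _))).
rewrite -(big_morph _ ReD Re0) /=.
rewrite (eq_bigr _ (fun z _ => esym (mulr_sumr _ _ _ _))) -mulr_suml.
rewrite -rmorph_sum -sqr_normc ComplexField.Normc.normcM.
rewrite ComplexField.Normc.normcV normc_nat.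
have -> (u : R[i]) : `|u| ^+ 2 = (normc u ^+ 2)%:C%C by rewrite rmorphXn.
by rewrite exprMn exprVn [in RHS]expr2 invfM mulrA.
Qed.

End Means.

(** * The averaging algorithm and its error probability *)

Section Tester.
Variables (R : realType) (gT : finGroupType).
Local Notation normc := ComplexField.Normc.normc.
Implicit Types (f : gT -> R[i]) (a : R[i]) (s : seq gT).

(** [w] and [w'] are to come from independent conjugators; the real part makes the estimate a real
    number. *)
Definition estimator a (u v w w' : R[i]) : R :=
  complex.Re ((u * v - a * w) * (u * v - a * w')^*%C).

Definition sample_estimator f x y z t : R :=
  estimator (f 1%g) (f x) (f y) (f (x * (z * y * z^-1))%g)
    (f (x * (t * y * t^-1))%g).

Lemma mean4_estimator f : mean4 (sample_estimator f) = defect f.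
Proof.
rewrite /defect -/(mean (fun x => mean _)); apply: eq_mean => x.
apply: eq_mean => y; rewrite /sample_estimator /estimator.
pose q z := f x * f y - f 1%g * f (x * (z * y * z^-1))%g.
rewrite (mean_Re_mul_conj q) /q big_split /= sumrN sumr_const.
congr (normc _ ^+ 2); rewrite mulrBl -[_ *+ _]mulr_natr.
by rewrite (mulfK (card_group_neq0 _ _)) -mulr_sumr -mulrA.
Qed.

Lemma sqr_estimator_le16 f x y z t :
  disk_valued f -> sample_estimator f x y z t ^+ 2 <= 16.
Proof.
move=> df; rewrite /sample_estimator /estimator; set w := f (x * _)%g.
have q_le2 (v : R[i]) : normc v <= 1 -> normc (f x * f y - f 1%g * v) <= 2.
  move=> v1; apply: le_trans (le_normcD _ _) _; rewrite normcN.
  have M (u u' : R[i]) : normc u <= 1 -> normc u' <= 1 -> normc (u * u') <= 1.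
    by move=> u1 u1'; rewrite ComplexField.Normc.normcM mulr_ile1 ?normc_ge0.
  by rewrite (_ : 2 = 1 + 1) // lerD // M.
set c := _ * _; have : `|complex.Re c| <= 4.
  rewrite -lecR; apply: le_trans (normc_ge_Re c) _.
  rewrite /c normrM normcJ !normr_complexE -rmorphM lecR (_ : 4 = 2 * 2); last by ring.
  by rewrite ler_pM ?normc_ge0 ?q_le2 //; apply: df.
rewrite -[_ ^+ 2]real_normK ?num_real // => c4.
have c0 := normr_ge0 (complex.Re c); nra.
Qed.

Lemma output_prob_total f s (A : algorithm R) :
  output_prob f true s A + output_prob f false s A = 1.
Proof.
elim: A s => [[]|A IHA B IHB|A IHA|u v A IHA B IHB|w k IHk] s /=.
- by rewrite addr0.
- by rewrite add0r.
- by rewrite -mulrDl addrACA IHA IHB divff // (@pnatr_eq0 R 2).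
- rewrite -mulrDl -big_split (eq_bigr _ (fun x _ => IHA _)) /=.
  by rewrite sumr_const divff // gt_eqF ?group_card_gt0.
- by case: ifP.
- exact: IHk.
Qed.

Definition conj_word x y z :=
  WordMul (Sampled x) (WordMul (WordMul (Sampled z) (Sampled y))
    (WordInv (Sampled z))).

(* [k] is the number of samples already drawn. *)
Fixpoint average_test a (theta : R) m k (acc : R) : algorithm R :=
  if m is m'.+1 then
    Sample (Sample (Sample (Sample
      (Query (Sampled k) (fun u => Query (Sampled k.+1) (fun v =>
       Query (conj_word k k.+1 k.+2) (fun w =>
       Query (conj_word k k.+1 k.+3) (fun w' =>
         average_test a theta m' k.+4 (acc + estimator a u v w w')))))))))
  else Answer R (acc <= theta).

(** With [size s] as counter, the indices point to the four fresh samples and never to the default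
    of [nth]. *)
Lemma output_prob_average_test f b s theta m acc :
  output_prob f b s (average_test (f 1%g) theta m.+1 (size s) acc) =
  mean4 (fun x y z t =>
    output_prob f b (rcons (rcons (rcons (rcons s x) y) z) t)
      (average_test (f 1%g) theta m (size s).+4 (acc + sample_estimator f x y z t))).
Proof.
rewrite /=; do 4![apply: eq_mean => ?] => /=.
rewrite -!cats1 -!catA /= !nth_cat.
rewrite ltnn subnn /= !ltnNge !leqW //= !subSn ?leqW // subnn /=.
by rewrite /sample_estimator !mulgA.
Qed.

(* Chebyshev's inequality, as an induction on the number of remaining rounds. *)
Lemma average_test_chebyshev f b theta c p m s acc :
    disk_valued f -> 0 < p ->
    (forall u, (u <= theta) == b -> p ^+ 2 <= (u - c) ^+ 2) ->
  output_prob f b s (average_test (f 1%g) theta m (size s) acc) <=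
    ((acc + m%:R * defect f - c) ^+ 2 + m%:R * 16) / p ^+ 2.
Proof.
move=> df p0 hb; have p2 : 0 < p ^+ 2 by rewrite exprn_gt0.
elim: m s acc => [|m IHm] s acc.
  rewrite /= !mul0r !addr0; case: (boolP ((acc <= theta) == b)) => [/hb h|_].
    by rewrite ler_pdivlMr ?mul1r.
  by rewrite divr_ge0 ?sqr_ge0.
rewrite output_prob_average_test.
set A := acc + m%:R * defect f - c.
(* The induction hypothesis is expanded as a quadratic polynomial in the estimate of this round, so
   that only its first two moments matter. *)
have step x y z t :
    output_prob f b (rcons (rcons (rcons (rcons s x) y) z) t)
      (average_test (f 1%g) theta m (size s).+4 (acc + sample_estimator f x y z t))
    <= (A ^+ 2 + m%:R * 16) / p ^+ 2
       + 2 * A / p ^+ 2 * sample_estimator f x y z t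
       + (p ^+ 2)^-1 * sample_estimator f x y z t ^+ 2.
  have := IHm (rcons (rcons (rcons (rcons s x) y) z) t) (acc + sample_estimator f x y z t).
  rewrite !size_rcons => /le_trans; apply.
  rewrite le_eqVlt; apply/orP; left; apply/eqP; rewrite /A; field.
  by rewrite gt_eqF.
apply: le_trans (le_mean4 step) _.
rewrite mean4_quadratic mean4_estimator.
have sq_le : mean4 (fun x y z t => sample_estimator f x y z t ^+ 2) <= 16.
  by rewrite -[leRHS](mean4_cst gT); apply: le_mean4 => x y z t; apply: sqr_estimator_le16.
rewrite -(ler_pM2r p2) divfK ?gt_eqF //.
set E := mean4 _ in sq_le *.
have -> : ((A ^+ 2 + m%:R * 16) / p ^+ 2 + 2 * A / p ^+ 2 * defect f
   + (p ^+ 2)^-1 * E) * p ^+ 2 = A ^+ 2 + m%:R * 16 + 2 * A * defect f + E.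
  by field; rewrite gt_eqF.
have -> : acc + m.+1%:R * defect f - c = A + defect f.
  by rewrite /A -natr1; ring.
(* What remains is [E <= defect f ^+ 2 + 16]. *)
rewrite -natr1; have := sqr_ge0 (defect f); nra.
Qed.

Lemma max_queries_average_test f a s theta m k acc :
  (max_queries f s (average_test a theta m k acc) <= 4 * m)%N.
Proof.
elim: m k s acc => [|m IHm] k s acc //; rewrite mulnS /=.
do 4![apply/bigmax_leqP => ? _]; exact: IHm.
Qed.

End Tester.

(** * Choice of parameters, correctness and query count *)

Definition num_rounds (R : realType) (eps : R) : nat := (Num.truncn (eps ^- 8)).+1.

(** The threshold is half of [16 * eps ^+ 4] per round, the least expected total for a far function.
    For [eps > 1 / 2] nothing is queried: the query bound vanishes at [eps = 1]. *)
Definition irr_char_tester (R : realType) (eps : R) : algorithm R :=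
  if eps <= 1 / 2 then
    Query WordOne (fun a => average_test a (8 * eps ^+ 4 * (num_rounds eps)%:R)
      (num_rounds eps) 0 0)
  else Answer R true.

Lemma num_roundsP (R : realType) (eps : R) :
  0 < eps -> eps ^- 8 < (num_rounds eps)%:R <= eps ^- 8 + 1.
Proof.
move=> e0; have e8 : 0 <= eps ^- 8 by rewrite invr_ge0 exprn_ge0 // ltW.
have /andP[le_t lt_t] := Num.Theory.truncn_itv e8.
by rewrite /num_rounds lt_t -natr1 lerD2r le_t.
Qed.

Section TesterCorrectness.
Variables (R : realType) (gT : finGroupType).
Local Notation normc := ComplexField.Normc.normc.
Local Notation prop_char := (@proportional_to_irreducible_character R gT).

(** Covers both kinds of error: the last hypothesis says that answer [b] forces the total to deviate
    from its mean by at least the threshold. *)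
Lemma irr_char_tester_error (f : gT -> R[i]) b (eps : R) :
    0 < eps -> eps <= 1 / 2 -> disk_valued f ->
    (forall u, (u <= 8 * eps ^+ 4 * (num_rounds eps)%:R) == b ->
       (8 * eps ^+ 4 * (num_rounds eps)%:R) ^+ 2 <=
         (u - (num_rounds eps)%:R * defect f) ^+ 2) ->
  output_prob f b [::] (irr_char_tester eps) <= 1 / 3.
Proof.
move=> e0 e2 df hb; rewrite /irr_char_tester e2 /=.
have /andP[N_gt _] := num_roundsP e0; move: N_gt hb.
set N := num_rounds eps; set theta := 8 * _ * _ => N_gt hb.
have e8 : 0 < eps ^- 8 by rewrite invr_gt0 exprn_gt0.
have N0 : 0 < N%:R :> R by apply: lt_trans N_gt.
have theta0 : 0 < theta by rewrite !mulr_gt0 // exprn_gt0.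
apply: le_trans (average_test_chebyshev N [::] 0 df theta0 hb) _.
rewrite add0r subrr expr0n add0r.
(* Chebyshev's bound is at most 1/4, since [N%:R] exceeds [eps ^- 8]. *)
have -> : N%:R * 16 / theta ^+ 2 = eps ^- 8 / N%:R / 4.
  by rewrite /theta; field; rewrite !gt_eqF.
have : eps ^- 8 / N%:R <= 1 by rewrite ler_pdivrMr // mul1r ltW.
lra.
Qed.

Lemma irr_char_tester_is_tester :
  is_tester prop_char (@irr_char_tester R).
Proof.
move=> eps e0 f df; have [e2|e2] := leP eps (1 / 2).
  have total := output_prob_total f [::] (irr_char_tester eps).
  have N0 : 0 <= (num_rounds eps)%:R :> R by [].
  have e4 : 0 < eps ^+ 4 by rewrite exprn_gt0.
  have theta0 : 0 <= 8 * eps ^+ 4 * (num_rounds eps)%:R by rewrite !mulr_ge0 // ltW.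
  rewrite /accept_prob /reject_prob; split=> [pf|far].
    suff : output_prob f false [::] (irr_char_tester eps) <= 1 / 3 by lra.
    apply: irr_char_tester_error => // u; rewrite (defect0 pf) mulr0 subr0 eqbF_neg.
    by rewrite -ltNge => lt_u; rewrite ler_sqr ?nnegrE // ltW // (le_lt_trans theta0).
  suff : output_prob f true [::] (irr_char_tester eps) <= 1 / 3 by lra.
  apply: irr_char_tester_error => // u /eqP u_le.
  (* The expected total is at least twice the threshold, while [u] is at most the threshold. *)
  have ge16 := eps_far_defect e0 df far; rewrite -[leRHS]sqrrN opprB.
  have := ler_wpM2l N0 ge16 => ge16N; rewrite ler_sqr ?nnegrE //; lra.
rewrite /accept_prob /reject_prob /irr_char_tester (lt_geF e2) /=.
split=> [_|far]; first by lra.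
(* Being far from 0 would force [4 * eps ^+ 2 <= 1], which contradicts [eps > 1 / 2]. *)
have := eps_far_sum e0 far _ (prop_char0 R gT).
move=> /(_ _)/wrap[]; first by move=> x; rewrite ComplexField.Normc.normc0.
under eq_bigr do rewrite subr0.
move=> le_S.
have S_le : \sum_x normc (f x) ^+ 2 <= #|gT|%:R.
  rewrite -sumr_const; apply: ler_sum => x _; apply: exprn_ile1 (df x).
  exact: normc_ge0.
have := le_trans le_S S_le; rewrite -{2}[#|gT|%:R]mul1r ler_pM2r ?group_card_gt0 //.
by move=> h; exfalso; nra.
Qed.

Lemma irr_char_tester_queries :
  query_complexity_le gT (@irr_char_tester R)
    (fun eps => 9 / ln 2 ^+ 2 * eps ^- 8 * ln (1 / eps) ^+ 2).
Proof.
move=> eps e0 f _; have ln2 : 0 < ln 2 :> R by rewrite ln_gt0 // ltr1n.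
have e8 : 0 < eps ^- 8 by rewrite invr_gt0 exprn_gt0.
rewrite /irr_char_tester; have [e2|_] := leP eps (1 / 2); last first.
  by rewrite /= mulr_ge0 ?sqr_ge0 // mulr_ge0 ?(ltW e8) // divr_ge0 ?sqr_ge0.
have e8_ge1 : 1 <= eps ^- 8 by rewrite invf_ge1 ?exprn_gt0 // exprn_ile1 //; lra.
have lnE : ln 2 <= ln (1 / eps).
  by rewrite ler_ln ?posrE ?divr_gt0 // ler_pdivlMr //; lra.
have /andP[_ N_le] := num_roundsP e0.
(* One query for [f 1%g] and four per round: at most [4 * (eps ^- 8 + 1) + 1], and [1 <= eps ^- 8]
   turns this into [9 * eps ^- 8]. *)
apply: (@le_trans _ _ (9 * eps ^- 8)); last first.
  have -> : 9 / ln 2 ^+ 2 * eps ^- 8 * ln (1 / eps) ^+ 2 =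
      9 * eps ^- 8 * (ln (1 / eps) ^+ 2 / ln 2 ^+ 2).
    by ring.
  apply: ler_peMr; first by rewrite mulr_ge0 // ltW.
  rewrite ler_pdivlMr ?exprn_gt0 // (mul1r (ln 2 ^+ 2)) ler_sqr // nnegrE ltW //.
  exact: lt_le_trans lnE.
apply: (@le_trans _ _ (4 * num_rounds eps).+1%:R).
  by rewrite ler_nat; apply: (max_queries_average_test f (f 1%g) [::] _ (num_rounds eps) 0 0).
by rewrite -natr1 natrM; lra.
Qed.

End TesterCorrectness.

Theorem theorem5p1 (R : realType) :
  exists C : R, forall gT : finGroupType, exists T : R -> algorithm R,
    is_tester (@proportional_to_irreducible_character R gT) T /\
    query_complexity_le gT T (fun eps => C * eps ^- 8 * ln (1 / eps) ^+ 2).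
Proof.
exists (9 / ln 2 ^+ 2) => gT; exists (@irr_char_tester R).
split; [exact: irr_char_tester_is_tester | exact: irr_char_tester_queries].
Qed.
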